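(* Let $\sigma(x)=\max(0,x)$ be the ReLU activation. Then for all $\mu\in\mathbb R$ and $\nu>0$, $$M_\sigma(\mu;\nu)=\sqrt{\nu}\,\phi\!\left(\frac{\mu}{\sqrt{\nu}}\right)+\mu\,\Phi\!\left(\frac{\mu}{\sqrt{\nu}}\right).$$
   Context: $\Phi$ and $\phi=\Phi'$ are the standard normal CDF and density. $M_\sigma(\mu;\nu):=\mathbb E\,\sigma(X)$ where $X\sim\mathcal N(\mu,\nu)$ ($\nu$ is the variance). *)

(* Defs.v *)
From HB Require Import structures.
From mathcomp Require Import all_boot all_order all_algebra.
From mathcomp Require Import all_classical all_reals all_analysis.
From mathcomp Require Import measurable_realfun.

Set Implicit Arguments.
Unset Strict Implicit.
Unset Printing Implicit Defensive.

Import Order.TTheory GRing.Theory Num.Theory.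
Import numFieldNormedType.Exports.

Local Open Scope classical_set_scope.
Local Open Scope ring_scope.

(* [normal_prob] takes the standard deviation, N(mu, nu) the variance.
   [normal_prob m 0] is the uniform law on [0, 1], so only nu > 0 is
   meaningful here. *)
Definition normal_law (R : realType) (mu nu : R) :
    probability (measurableTypeR R) R :=
  normal_prob mu (Num.sqrt nu).

Definition is_normal d (T : measurableType d) (R : realType)
    (P : probability T R) (X : {RV P >-> R}) (mu nu : R) :=
  forall A, measurable A -> distribution P X A = normal_law mu nu A.

(* Under [normal_law mu nu], the identity is a random variable X ~ N(mu, nu);
   for measurable sigma, any other choice of X gives the same mean, by
   [gaussian_meanE]. *)
Definition id_rv (R : realType) (x : measurableTypeR R) : R := x.

HB.instance Definition _ (R : realType) :=
  @isMeasurableFun.Build _ _ _ _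
    (@id_rv R) (@measurable_id _ _ setT).

Definition gaussian_mean (R : realType) (sigma : R -> R) (mu nu : R) : \bar R :=
  'E_(normal_law mu nu)[sigma \o @id_rv R].

Definition std_normal_cdf (R : realType) (x : R) : R :=
  fine (cdf (@id_rv R : {RV (normal_law 0 1) >-> R}) x).

Definition std_normal_pdf (R : realType) (x : R) : R := normal_pdf 0 1 x.

Definition relu (R : realType) (x : R) : R := Num.max 0 x.

Lemma gaussian_meanE d (T : measurableType d) (R : realType)
    (P : probability T R) (X : {RV P >-> R})
    (sigma : R -> R) (mu nu : R) :
  measurable_fun [set: R] sigma -> is_normal X mu nu ->
  'E_P[sigma \o X]%E = gaussian_mean sigma mu nu.
Proof.
move=> ms XN; rewrite /gaussian_mean unlock.
have H (f : R -> \bar R) : measurable_fun setT f -> (forall x, 0 <= f x)%E ->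
    (\int[P]_x f (X x) = \int[normal_law mu nu]_x f (id_rv x))%E.
  move=> mf f0.
  pose Y : {RV (normal_law mu nu) >-> R} := @id_rv R.
  transitivity (\int[distribution P X]_y f y)%E.
    by rewrite ge0_integral_distribution.
  transitivity (\int[distribution (normal_law mu nu) Y]_y f y)%E.
    by apply: eq_measure_integral => A mA _; exact: XN.
  by rewrite ge0_integral_distribution.
have mE : measurable_fun setT (EFin \o sigma) by exact/measurable_EFinP.
rewrite [LHS]integralE [RHS]integralE; congr (_ - _)%E.
  by have := H _ (measurable_funepos mE) (funepos_ge0 _); rewrite !funepos.unlock.
by have := H _ (measurable_funeneg mE) (funeneg_ge0 _); rewrite !funeneg.unlock.
Qed.

Lemma std_normal_cdfE (R : realType) (x : R) :
  std_normal_cdf x = (\int[lebesgue_measure]_(t in `]-oo, x]) std_normal_pdf t)%R.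
Proof.
by rewrite /std_normal_cdf /cdf /distribution /= /pushforward /normal_law sqrtr1.
Qed.

Lemma derive1_std_normal_cdf (R : realType) (x : R) :
  derivable (@std_normal_cdf R) x 1 /\ (@std_normal_cdf R)^`()%classic x = std_normal_pdf x.
Proof.
rewrite (_ : @std_normal_cdf R = fun y =>
  (\int[lebesgue_measure]_(t in `]-oo, y]) std_normal_pdf t)%R); last first.
  by apply/funext => y; exact: std_normal_cdfE.
apply: (@continuous_FTC1 R _ -oo%O x (x + 1)) => //.
- by rewrite ltrDl.
- apply: (integrableS _ _ (subsetT _)) => //; exact: integrable_normal_pdf.
- by rewrite ltNyr.
- exact: (@continuous_normal_pdf R 0 1 (oner_neq0 _) x).
Qed.

Lemma std_normal_pdfE (R : realType) (x : R) :
  std_normal_pdf x = expR (- x ^+ 2 / 2) / Num.sqrt (2 * pi).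
Proof.
rewrite /std_normal_pdf normal_pdfE ?oner_eq0// /normal_peak /normal_fun.
by rewrite subr0 expr1n mul1r mulrC mulr_natl.
Qed.

(* Main.v *)
(** With s = sqrt nu, the function
    F(x) = - (s phi((mu - x) / s) + mu Phi((mu - x) / s))
    is an antiderivative of x times the density of N(mu, nu) and vanishes at
    +oo, so the integral over [0, +oo[ is - F(0). Using the argument
    (mu - x) / s instead of (x - mu) / s makes the symmetry of Phi
    unnecessary. *)

Require Import Defs.
From mathcomp Require Import all_boot all_order all_algebra.
From mathcomp Require Import all_classical all_reals all_analysis.
From mathcomp Require Import measurable_realfun charge ring.
Import Order.TTheory GRing.Theory Num.Theory.
Import numFieldNormedType.Exports.
Local Open Scope classical_set_scope.
Local Open Scope ring_scope.

(** Change of variables through the Radon-Nikodym derivative of [normal_prob m s], which is then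
    traded for the explicit density. *)
Lemma ge0_integral_normal_prob (R : realType) (m s : R) (f : R -> R) :
  measurable_fun [set: R] f -> (forall x, 0 <= f x) ->
  (\int[normal_prob m s]_x (f x)%:E =
   \int[lebesgue_measure]_x (f x * normal_pdf m s x)%:E)%E.
Proof.
move=> mf f0; have dom := @normal_prob_dominates R m s.
have mEf : measurable_fun setT (EFin \o f) by exact/measurable_EFinP.
have mp := @measurable_normal_pdf R m s.
rewrite -(Radon_Nikodym_SigmaFinite.change_of_variables dom)//.
have RNi := Radon_Nikodym_SigmaFinite.f_integrable dom.
apply: ae_eq_integral => //.
- by apply: emeasurable_funM => //; exact: measurable_int RNi.
- exact/measurable_EFinP/measurable_funM.
(* The derivative and [normal_pdf m s] have the same integral over every measurable set, hence agree
   almost everywhere. *)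
- have pdfE := @integral_ae_eq _ _ R lebesgue_measure setT measurableT
    (EFin \o normal_pdf m s) _ RNi.
  apply: filterS (pdfE _ _) => [x /= RNE _||]; first by rewrite RNE// EFinM.
    exact/measurable_EFinP.
  by move=> E _ mE; rewrite -(Radon_Nikodym_SigmaFinite.f_integral dom).
Qed.

Lemma is_derive_std_normal_pdf (R : realType) (x : R) :
  is_derive x 1 (@std_normal_pdf R) (- x * std_normal_pdf x).
Proof.
rewrite (_ : @std_normal_pdf R =
    fun y => expR (- y ^+ 2 / 2) / Num.sqrt (2 * pi)); last first.
  by apply/funext => y; exact: std_normal_pdfE.
apply: is_derive_eq.
rewrite /GRing.scale /=.
(* Both sides are linear in the normalizing factor, so it can be any constant [c]. *)
by move: (Num.sqrt _)^-1 => c; field.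
Qed.

Lemma is_derive_std_normal_cdf (R : realType) (x : R) :
  is_derive x 1 (@std_normal_cdf R) (std_normal_pdf x).
Proof.
have [d <-] := derive1_std_normal_cdf x.
by rewrite derive1E; exact/derivableP.
Qed.

Lemma cvg_std_normal_cdfNy (R : realType) :
  @std_normal_cdf R x @[x --> -oo] --> (0 : R).
Proof.
have := @cvg_cdfNy0 _ _ R _ (@id_rv R : {RV (normal_law 0 1) >-> R}).
by move/fine_cvg.
Qed.

Lemma cvg_std_normal_pdfNy (R : realType) :
  @std_normal_pdf R x @[x --> -oo] --> (0 : R).
Proof.
(* Reflecting to +oo exhibits the density as exp(-y) at y = x^2/2, up to a constant factor. *)
suff : (@std_normal_pdf R \o -%R) x @[x --> +oo] --> (0 : R).
  by move/(cvgNy_compNP (@std_normal_pdf R) (nbhs (0 : R))).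
rewrite (_ : _ \o _ = fun x : R =>
    (fun y => expR (- y)) (x ^+ 2 / 2) * (Num.sqrt (2 * pi))^-1); last first.
  by apply/funext => x; rewrite /= std_normal_pdfE sqrrN mulNr.
rewrite -(mul0r (Num.sqrt (2 * pi))^-1); apply: cvgM; last exact: cvg_cst.
have sqy : x ^+ 2 / 2 @[x --> +oo] --> (+oo : set_system R).
  by apply: gt0_cvgMly; [rewrite invr_gt0|exact: cvgr_expr2].
exact: cvg_comp sqy (@cvgr_expR R).
Qed.

(** The reflected argument is harmless because it enters only through its square. *)
Lemma normal_pdf_std (R : realType) (m s x : R) : 0 < s ->
  normal_pdf m s x = std_normal_pdf ((m - x) / s) / s.
Proof.
move=> s0; rewrite std_normal_pdfE normal_pdfE ?gt_eqF// /normal_peak /normal_fun.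
rewrite -mulrnAr sqrtrM ?sqr_ge0// sqrtr_sqr gtr0_norm// mulr_natl.
rewrite invfM mulrC [s^-1 / _]mulrC mulrA; congr (_ / _ / _).
by congr expR; field; rewrite gt_eqF.
Qed.

Definition relu_primitive (R : realType) (m s x : R) : R :=
  - (s * std_normal_pdf ((m - x) / s) + m * std_normal_cdf ((m - x) / s)).

(** With z = (m - x) / s and phi'(z) = - z phi(z), the chain rule gives (m / s - z) phi(z) = x
    phi(z) / s. *)
Lemma is_derive_relu_primitive (R : realType) (m s x : R) : 0 < s ->
  is_derive x 1 (relu_primitive R m s) (x * normal_pdf m s x).
Proof.
move=> s0; pose g (y : R) := (m - y) / s.
have dg : is_derive x 1 g (- s^-1).
  by apply: is_derive_eq; rewrite /GRing.scale /=; ring.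
have dpdf := is_derive1_comp (is_derive_std_normal_pdf R (g x)) dg.
have dcdf := is_derive1_comp (is_derive_std_normal_cdf R (g x)) dg.
rewrite (_ : relu_primitive R m s = fun y => - (s * (@std_normal_pdf R \o g) y
  + m * (@std_normal_cdf R \o g) y))//.
apply: is_derive_eq.
rewrite normal_pdf_std// /g /GRing.scale /=; field.
by rewrite gt_eqF.
Qed.

Lemma cvg_relu_primitive (R : realType) (m s : R) : 0 < s ->
  relu_primitive R m s x @[x --> +oo] --> (0 : R).
Proof.
(* The argument tends to -oo, where phi and Phi both vanish. *)
move=> s0; have cg : (m - x) / s @[x --> +oo] --> -oo.
  apply: gt0_cvgMlNy; first by rewrite invr_gt0.
  apply/cvgNry; rewrite (_ : - _ = fun x => x - m); first exact: cvg_addrr.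
  by apply/funext => x; rewrite /= opprB.
have := cvgN (cvgD (cvgM (cvg_cst s) (cvg_comp _ _ cg (cvg_std_normal_pdfNy R)))
  (cvgM (cvg_cst m) (cvg_comp _ _ cg (cvg_std_normal_cdfNy R)))).
by rewrite !mulr0 addr0 oppr0; exact.
Qed.

Lemma integral_x_normal_pdf (R : realType) (m s : R) : 0 < s ->
  (\int[lebesgue_measure]_(x in `[0%R, +oo[) (x * normal_pdf m s x)%:E =
   (s * std_normal_pdf (m / s) + m * std_normal_cdf (m / s))%:E)%E.
Proof.
move=> s0.
have dF x := is_derive_relu_primitive R m s x s0.
have cF x : {for x, continuous (relu_primitive R m s)}.
  apply/differentiable_continuous/derivable1_diffP.
  by have [] := dF x.
(* The integrand is nonnegative on [0, +oo[, so the integral is the limit 0 of the primitive minus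
   its value at 0. *)
rewrite (@ge0_continuous_FTC2y _ _ (relu_primitive R m s) _ 0)//.
- by rewrite sub0e /relu_primitive subr0 -EFinN opprK.
- by move=> x x0; rewrite mulr_ge0// normal_pdf_ge0.
- apply: continuous_subspaceT => x; apply: cvgM => //.
  by apply: continuous_normal_pdf; rewrite gt_eqF.
- exact: cvg_relu_primitive.
- exact: cvg_at_right_filter (cF 0).
- by move=> x _; rewrite derive1E; have [] := dF x.
Qed.

Theorem lemmaE1 (R : realType) (mu nu : R) (nu_gt0 : 0 < nu) :
  gaussian_mean (@relu R) mu nu =
  (Num.sqrt nu * std_normal_pdf (mu / Num.sqrt nu)
   + mu * std_normal_cdf (mu / Num.sqrt nu))%:E.
Proof.
rewrite /gaussian_mean unlock /normal_law.
rewrite (@ge0_integral_normal_prob R mu (Num.sqrt nu) (@relu R)); last first.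
- by move=> x; rewrite le_max lexx.
- exact: measurable_maxr.
(* Extended by zero to the whole line, the integrand on [0, +oo[ is [relu] times the density. *)
rewrite -integral_x_normal_pdf ?sqrtr_gt0// [RHS]integral_mkcond.
apply: eq_integral => x _; rewrite patchE /relu.
rewrite mem_setE in_itv /= andbT; case: ifPn => [/max_idPr->//|].
by rewrite -ltNge => /ltW/max_idPl->; rewrite mul0r.
Qed.
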